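(* Every intrinsic net $(X,\mathcal{A})$ (on a closed oriented surface) has a preferred lifting.
   Context: $\mathbb{H}$ has units $\mathbf{i},\mathbf{j},\mathbf{k}$; $\mathrm{Spin}(2)=\{\cos a+\sin a\,\mathbf{k}\}\subset\mathbb{H}$. Oriented net: $X=(V,E,F)$ is a finite connected cell complex decomposing a closed oriented surface into polygonal faces; two adjacent faces share exactly one edge, and every edge is shared by exactly two faces. Edges of each face carry its boundary orientation. Intrinsic net $(X,\mathcal{A})$: each face $\Delta_i$ carries an oriented Euclidean affine plane $\mathrm{Affine}(\Delta_i)$, and each edge of $\Delta_i$ (shared with $\Delta_j$, oriented as in $\Delta_i$) is assigned a nonzero tangent vector $e^i_{ij}$ (a vector attached to a point) of that plane, such that the edge has the same length in both faces, and for each face the extension lines of its vectors form a convex polygon with counterclockwise orientation (sides in the cyclic order of the edges of the face and directed by the $e^i_{ij}$). The vectors of a face need not form a closed polygon. The interior angle of $\Delta_i$ at one of its vertices $v$ is the interior angle of this convex polygon between the two extension lines of the edges of $\Delta_i$ meeting at $v$; all vertices are then regular (these angles lie in $(0,\pi)$). The angular defect $K(v)$ is $2\pi$ minus the sum of the interior angles at $v$ of the faces around $v$. Liftings: choose an oriented orthonormal frame at each face; $e^i_{ij}$ becomes $\mathfrak{e}^i_{ij}\in\mathrm{span}\{\mathbf{i},\mathbf{j}\}$, and $\mathfrak{e}^j_{ij}:=-\mathfrak{e}^j_{ji}$. A lifting (of the Levi-Civita connection to a spinor connection) is a choice of $g_{ij}\in\mathrm{Spin}(2)$ for all ordered adjacent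 pairs with $g_{ji}=g_{ij}^{-1}$ and $\mathfrak{e}^j_{ij}=g_{ij}^{-1}\mathfrak{e}^i_{ij}g_{ij}$; each edge admits exactly two choices, differing by sign. Preferred lifting: a lifting such that for every vertex $v$, with $\Delta_1,\dots,\Delta_n$ the faces around $v$ in clockwise order, $$g_{12}\cdot g_{23}\cdots g_{n,1}=\cos\frac{K(v)}2+\sin\frac{K(v)}2\,\mathbf{k}.$$ *)

(* Defs.v *)
From HB Require Import structures.
From mathcomp Require Import all_boot all_order all_algebra.
From mathcomp Require Import ring lra.
From mathcomp Require Import reals trigo.

Set Implicit Arguments.
Unset Strict Implicit.
Unset Printing Implicit Defensive.

Import Order.TTheory GRing.Theory Num.Theory.
Local Open Scope ring_scope.

(** * Quaternions *)

(* [Quat a b c d] is a + b i + c j + d k. *)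
Record quat (R : Type) := Quat { qr : R; qi : R; qj : R; qk : R }.

Definition quat_tuple R (q : quat R) : R * R * R * R :=
  (qr q, qi q, qj q, qk q).
Definition tuple_quat R (t : R * R * R * R) : quat R :=
  let: (a, b, c, d) := t in Quat a b c d.
Lemma quat_tupleK R : cancel (@quat_tuple R) (@tuple_quat R).
Proof. by case. Qed.

HB.instance Definition _ (R : realFieldType) :=
  Choice.copy (quat R) (can_type (@quat_tupleK R)).

Definition addq (R : realFieldType) (x y : quat R) : quat R :=
  Quat (qr x + qr y) (qi x + qi y) (qj x + qj y) (qk x + qk y).
Definition oppq (R : realFieldType) (x : quat R) : quat R :=
  Quat (- qr x) (- qi x) (- qj x) (- qk x).
Definition mulq (R : realFieldType) (x y : quat R) : quat R :=
  Quat (qr x * qr y - qi x * qi y - qj x * qj y - qk x * qk y)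
       (qr x * qi y + qi x * qr y + qj x * qk y - qk x * qj y)
       (qr x * qj y - qi x * qk y + qj x * qr y + qk x * qi y)
       (qr x * qk y + qi x * qj y - qj x * qi y + qk x * qr y).
Definition sqnormq (R : realFieldType) (x : quat R) : R :=
  qr x ^+ 2 + qi x ^+ 2 + qj x ^+ 2 + qk x ^+ 2.
Definition invq (R : realFieldType) (x : quat R) : quat R :=
  Quat (qr x / sqnormq x) (- qi x / sqnormq x)
       (- qj x / sqnormq x) (- qk x / sqnormq x).

Lemma addqA (R : realFieldType) : associative (@addq R).
Proof. by case=> ? ? ? ? [? ? ? ?] [? ? ? ?]; congr Quat; rewrite /= addrA. Qed.
Lemma addqC (R : realFieldType) : commutative (@addq R).
Proof. by case=> ? ? ? ? [? ? ? ?]; congr Quat; rewrite /= addrC. Qed.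
Lemma add0q (R : realFieldType) : left_id (Quat 0 0 0 0) (@addq R).
Proof. by case=> ? ? ? ?; congr Quat; rewrite /= add0r. Qed.
Lemma addNq (R : realFieldType) :
  left_inverse (Quat 0 0 0 0) (@oppq R) (@addq R).
Proof. by case=> ? ? ? ?; congr Quat; rewrite /= addNr. Qed.

HB.instance Definition _ (R : realFieldType) :=
  GRing.isZmodule.Build (quat R) (@addqA R) (@addqC R) (@add0q R) (@addNq R).

Lemma mulqA (R : realFieldType) : associative (@mulq R).
Proof. by case=> ? ? ? ? [? ? ? ?] [? ? ? ?]; congr Quat; rewrite /=; ring. Qed.
Lemma mul1q (R : realFieldType) : left_id (Quat 1 0 0 0) (@mulq R).
Proof. by case=> ? ? ? ?; congr Quat; rewrite /=; ring. Qed.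
Lemma mulq1 (R : realFieldType) : right_id (Quat 1 0 0 0) (@mulq R).
Proof. by case=> ? ? ? ?; congr Quat; rewrite /=; ring. Qed.
Lemma mulqDl (R : realFieldType) : left_distributive (@mulq R) +%R.
Proof. by case=> ? ? ? ? [? ? ? ?] [? ? ? ?]; congr Quat; rewrite /=; ring. Qed.
Lemma mulqDr (R : realFieldType) : right_distributive (@mulq R) +%R.
Proof. by case=> ? ? ? ? [? ? ? ?] [? ? ? ?]; congr Quat; rewrite /=; ring. Qed.
Lemma oneq_neq0 (R : realFieldType) : Quat 1 0 0 0 != 0 :> quat R.
Proof. by apply/eqP; case=> /eqP; rewrite oner_eq0. Qed.

HB.instance Definition _ (R : realFieldType) :=
  GRing.Zmodule_isNzRing.Build (quat R)
    (@mulqA R) (@mul1q R) (@mulq1 R) (@mulqDl R) (@mulqDr R) (oneq_neq0 R).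

Lemma sqnormq_neq0 (R : realFieldType) (x : quat R) :
  x != 0 -> sqnormq x != 0.
Proof.
apply: contra; case: x => a b c d; rewrite /sqnormq /=.
rewrite !paddr_eq0 ?addr_ge0 ?sqr_ge0 // !sqrf_eq0.
by move=> /andP[/andP[/andP[/eqP-> /eqP->] /eqP->] /eqP->].
Qed.

Lemma mulVq (R : realFieldType) :
  {in [pred x : quat R | x != 0], left_inverse 1 (@invq R) *%R}.
Proof.
move=> x /sqnormq_neq0; case: x => a b c d.
by rewrite /sqnormq /= => nz; congr Quat; rewrite /= /sqnormq /=; field.
Qed.
Lemma mulqV (R : realFieldType) :
  {in [pred x : quat R | x != 0], right_inverse 1 (@invq R) *%R}.
Proof.
move=> x /sqnormq_neq0; case: x => a b c d.
by rewrite /sqnormq /= => nz; congr Quat; rewrite /= /sqnormq /=; field.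
Qed.
Lemma unitqP (R : realFieldType) (x y : quat R) :
  y * x = 1 /\ x * y = 1 -> [pred x : quat R | x != 0] x.
Proof.
case=> _ xy1; apply/eqP => x0; move: xy1; rewrite x0 mul0r => /esym/eqP.
by rewrite oner_eq0.
Qed.
Lemma invq_out (R : realFieldType) :
  {in [predC [pred x : quat R | x != 0]], @invq R =1 id}.
Proof.
by move=> x; rewrite !inE negbK => /eqP->; congr Quat; rewrite /= ?oppr0 mul0r.
Qed.

HB.instance Definition _ (R : realFieldType) :=
  GRing.NzRing_hasMulInverse.Build (quat R)
    (@mulVq R) (@mulqV R) (@unitqP R) (@invq_out R).

(* cos a + sin a k *)
Definition expk (R : realType) (a : R) : quat R := Quat (cos a) 0 0 (sin a).

Definition Spin2 (R : realType) (q : quat R) : Prop := exists a, q = expk a.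

(** * Oriented Euclidean affine planes *)

(* [vect p q] is the vector q - p (Weyl's axioms).  The orientation is carried
   by the Euclidean area form [area]: the normalization [area_sqr] leaves
   exactly two forms, opposite to each other, one for each orientation. *)
Record eplane (R : realType) := EPlane {
  point : Type;
  tangent : vectType R;
  vect : point -> point -> tangent;
  inner : tangent -> tangent -> R;
  area : tangent -> tangent -> R;
  point_inhabited : inhabited point;
  tangent_dim : \dim {: tangent} = 2%N;
  vect_chasles : forall p q r, vect p q + vect q r = vect p r;
  vect_bij : forall p, bijective (vect p);
  inner_linear : forall (a : R) u v w,
    inner (a *: u + v) w = a * inner u w + inner v w;
  inner_sym : forall u v, inner u v = inner v u;
  inner_gt0 : forall u, u != 0 -> 0 < inner u u;
  area_linear : forall (a : R) u v w,
    area (a *: u + v) w = a * area u w + area v w;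
  area_anti : forall u v, area u v = - area v u;
  area_sqr : forall u v,
    area u v ^+ 2 = inner u u * inner v v - inner u v ^+ 2
}.

Definition norm (R : realType) (P : eplane R) (u : tangent P) : R :=
  Num.sqrt (inner u u).

(* Unoriented angle of two nonzero vectors, in [0, pi]. *)
Definition angle (R : realType) (P : eplane R) (u v : tangent P) : R :=
  acos (inner u v / (norm u * norm v)).

Definition on_line (R : realType) (P : eplane R)
    (p : point P) (e : tangent P) (q : point P) : Prop :=
  exists t : R, vect p q = t *: e.

(* The closed polygon c_0 c_1 ... c_(n-1) is convex, without flat corners,
   and runs counterclockwise: every corner not on the side c_k c_(k+1) lies
   strictly to the left of that side. *)
Definition convex_ccw (R : realType) (P : eplane R) (n : nat)
    (c : 'I_n -> point P) : Prop :=
  (2 < n)%N /\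
  forall k l : 'I_n, l != k -> l != ordS k ->
    0 < area (vect (c k) (c (ordS k))) (vect (c k) (c l)).

Definition interior_angle (R : realType) (P : eplane R) (n : nat)
    (c : 'I_n -> point P) (k : 'I_n) : R :=
  angle (vect (c k) (c (ord_pred k))) (vect (c k) (c (ordS k))).

Record frame (R : realType) (P : eplane R) := Frame {
  fr1 : tangent P;
  fr2 : tangent P;
  fr1_unit : inner fr1 fr1 = 1;
  fr2_unit : inner fr2 fr2 = 1;
  fr_orth : inner fr1 fr2 = 0;
  fr_oriented : area fr1 fr2 = 1
}.

(* The vector x fr1 + y fr2 is read as the quaternion x i + y j. *)
Definition quat_of (R : realType) (P : eplane R) (b : frame P)
    (u : tangent P) : quat R :=
  Quat 0 (inner (fr1 b) u) (inner (fr2 b) u) 0.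

(** * Oriented nets *)

(* A cell decomposition of a closed oriented surface, presented by its faces
   and their gluing.  The sides of the face f, in the cyclic order given by the
   orientation, are indexed by 'I_(nsides f); a dart (f, k) is the k-th side of
   f with its boundary orientation.  The side d is glued to the side [opp d] of
   the adjacent face, with opposite direction.  Hence the edges are the pairs
   {d, opp d}, and the vertices are the classes of the darts for "having the
   same origin", i.e. the orbits of [cw] below. *)
Definition dart_of (F : finType) (n : F -> nat) := {f : F & 'I_(n f)}.

Record oriented_net := OrientedNet {
  face : finType;
  nsides : face -> nat;
  opp : dart_of nsides -> dart_of nsides;
  nsides_gt2 : forall f, (2 < nsides f)%N;
  opp_invol : involutive opp;
  two_faces : forall d, tag (opp d) != tag d;
  one_common_edge : forall d d',
    tag d = tag d' -> tag (opp d) = tag (opp d') -> d = d';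
  net_connected : forall f f',
    connect [rel i j | [exists d, (tag d == i) && (tag (opp d) == j)]] f f'
}.

Definition dart (X : oriented_net) : finType := {f : face X & 'I_(nsides f)}.

Definition next_side (X : oriented_net) (d : dart X) : dart X :=
  Tagged (fun f => 'I_(nsides f)) (ordS (tagged d)).

(* With boundaries running counterclockwise, the dart leaving the origin of d
   that comes just after d in clockwise order lies in the face across d: it is
   the side following [opp d] there. *)
Definition cw (X : oriented_net) (d : dart X) : dart X := next_side (opp d).

(** * Intrinsic nets *)

(* [evec f k], attached at [anchor f k], is the vector assigned to the k-th side
   of f.  [corner f k] is the corner of the convex polygon where the extension
   lines of the sides k-1 and k meet; it is determined by these lines. *)
Record intrinsic_net (R : realType) (X : oriented_net) := IntrinsicNet {
  plane : face X -> eplane R;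
  anchor : forall f, 'I_(nsides f) -> point (plane f);
  evec : forall f, 'I_(nsides f) -> tangent (plane f);
  corner : forall f, 'I_(nsides f) -> point (plane f);
  evec_neq0 : forall f (k : 'I_(nsides f)), evec k != 0;
  same_length : forall d : dart X,
    norm (evec (tagged d)) = norm (evec (tagged (opp d)));
  corner_line : forall f (k : 'I_(nsides f)),
    on_line (anchor k) (evec k) (corner k);
  corner_next_line : forall f (k : 'I_(nsides f)),
    on_line (anchor k) (evec k) (corner (ordS k));
  side_directed : forall f (k : 'I_(nsides f)),
    exists2 t : R, 0 < t & vect (corner k) (corner (ordS k)) = t *: evec k;
  corner_convex : forall f, convex_ccw (@corner f)
}.

(* The angular defect at the origin of d. *)
Definition angular_defect (R : realType) (X : oriented_net)
    (A : intrinsic_net R X) (d : dart X) : R :=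
  2 * pi - \sum_(d' <- orbit (@cw X) d)
             interior_angle (@corner R X A (tag d')) (tagged d').

(** * Liftings *)

Definition frames (R : realType) (X : oriented_net) (A : intrinsic_net R X) :=
  forall f, frame (plane A f).

(* For a side d of the i-th face shared with the j-th one, e^i_ij is [qvec b d]
   and e^j_ij = - e^j_ji is [- qvec b (opp d)]. *)
Definition qvec (R : realType) (X : oriented_net) (A : intrinsic_net R X)
    (b : frames A) (d : dart X) : quat R :=
  quat_of (b (tag d)) (evec A (tagged d)).

(* Only the values of g at pairs of adjacent faces matter. *)
Definition lifting (R : realType) (X : oriented_net) (A : intrinsic_net R X)
    (b : frames A) (g : face X -> face X -> quat R) : Prop :=
  forall d : dart X, let i := tag d in let j := tag (opp d) in
  [/\ Spin2 (g i j), g j i = (g i j)^-1 &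
      - qvec b (opp d) = (g i j)^-1 * qvec b d * g i j].

(* [orbit (@cw X) d] lists, in clockwise order, the darts leaving the origin of
   d, one for each (corner of a) face around this vertex; [cw] maps the last one
   back to d, which closes the product. *)
Definition preferred_lifting (R : realType) (X : oriented_net)
    (A : intrinsic_net R X) (b : frames A)
    (g : face X -> face X -> quat R) : Prop :=
  lifting b g /\
  forall d : dart X,
    \prod_(d' <- orbit (@cw X) d) g (tag d') (tag (cw d')) =
    expk (angular_defect A d / 2).

(* Main.v *)
Require Import Defs.
From mathcomp Require Import all_boot all_order all_algebra.
From mathcomp Require Import fingroup perm.
From mathcomp Require Import zify ring lra.
From mathcomp Require Import reals trigo.

Set Implicit Arguments.
Unset Strict Implicit.
Unset Printing Implicit Defensive.

Import Order.TTheory GRing.Theory Num.Theory.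

(** Identify the tangent plane of every face with the complex plane through its
    frame and let theta(d) be an argument of the vector attached to the side d.
    Conjugation by cos a + sin a k rotates span(i, j) by -2a, so the liftings
    are exactly the families g = expk(a) with
      a(d) = (theta(d) - theta(opp d) - pi) / 2 + pi eps(d),
    where eps(d) is a bit with eps(opp d) = 1 - eps(d); the last condition
    is g_ji = g_ij^-1.

    Around a vertex the product of the g is expk of the sum of the a(d).
    Rearranged, this sum involves the differences theta(d) - theta(prev d) of
    consecutive sides of one face, that is, its exterior angles pi - int(d).
    The arguments of the sides of a convex polygon can be chosen increasing
    within one turn, so that the equality holds without error except at one
    marked side of every face, where a full turn is lost ([side_arguments]).
    The sum is therefore - (sum of int) / 2 + pi (number of eps + number of
    marked sides), up to full turns, whereas half of the angular defect is
    pi - (sum of int) / 2.  So the lifting is preferred if and only if, at every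
    vertex, the number of darts d with eps(d) = 1 plus the number of marked
    darts is odd.

    This is a linear system over the field with two elements.  Reversing eps on
    an edge changes the parity at both of its end points, and the net is
    connected, so along paths every vertex can be corrected at the expense of
    one chosen vertex ([joined_all]).  The last vertex is then right if the
    total is: the total number of bits and marks is E + F and it has to be V
    modulo 2.  That V - E + F is even holds for every closed oriented surface,
    and has here a short proof by signs of permutations: turning around vertices
    is the composite of the edge involution and of the rotation of the faces,
    and the sign of a permutation is the parity of the number of points minus
    the number of cycles ([euler_parity]).  The conclusion of this
    combinatorial part is [exists_spin_signs]. *)

(** * Sums over the orbits of a permutation *)

Lemma odd_sum_addb (I : Type) (r : seq I) (P : pred I) (F : I -> nat) :
  odd (\sum_(i <- r | P i) F i) = \big[addb/false]_(i <- r | P i) odd (F i).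
Proof. exact: (big_morph _ oddD). Qed.

Lemma addb_card (T : finType) (P : pred T) :
  \big[addb/false]_x P x = odd #|P|.
Proof.
rewrite -sum1_card [in RHS]big_mkcond odd_sum_addb.
by apply: eq_bigr => x _; rewrite unfold_in; case: (P x).
Qed.

Lemma card_porbits_transversal (T : finType) (s : {perm T}) (P : pred T) :
    (forall x, exists2 y, P y & y \in porbit s x) ->
    {in P &, forall x y, y \in porbit s x -> x = y} ->
  #|porbits s| = #|P|.
Proof.
move=> exP uniqP; rewrite -(@card_in_imset _ _ (porbit s) P); last first.
  by move=> x y Px Py /eqP; rewrite eq_sym eq_porbit_mem; apply: uniqP.
apply: eq_card => B; apply/imsetP/imsetP => -[x _ ->]; last by exists x.
have [y Py yx] := exP x; exists y => //.
by apply/eqP; rewrite eq_porbit_mem porbit_sym.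
Qed.

Lemma big_partition_porbits (T : finType) (s : {perm T}) (R : Type) (idx : R)
    (op : Monoid.com_law idx) (F : T -> R) :
  \big[op/idx]_x F x =
  \big[op/idx]_(B in porbits s) \big[op/idx]_(x in B) F x.
Proof.
rewrite (partition_big_imset (porbit s)); apply: eq_bigr => _ /imsetP[x _ ->].
by apply: eq_bigl => y; rewrite eq_porbit_mem.
Qed.

Lemma fconnect_perm (T : finType) (f : T -> T) (f_inj : injective f) x y :
  fconnect f x y = (y \in porbit (perm f_inj) x).
Proof.
have iterE n : iter n f x = (perm f_inj ^+ n)%g x.
  by elim: n => [|n IHn]; rewrite ?expg0 ?perm1 // expgSr permM permE -IHn.
apply/idP/porbitP => [/iter_findex <- | [n ->]]; first by exists (findex f x y).
by rewrite -iterE fconnect_iter.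
Qed.

Lemma big_orbit_perm (T : finType) (f : T -> T) (f_inj : injective f)
    (R : Type) (idx : R) (op : Monoid.com_law idx) x (F : T -> R) :
  \big[op/idx]_(y <- orbit f x) F y =
  \big[op/idx]_(y in porbit (perm f_inj) x) F y.
Proof.
rewrite (big_uniq _ (orbit_uniq f x)); apply: eq_bigl => y.
by rewrite -fconnect_orbit (fconnect_perm f_inj).
Qed.

Lemma big_orbit_shift (T : finType) (f : T -> T) (f_inj : injective f)
    (R : Type) (idx : R) (op : Monoid.com_law idx) x (F : T -> R) :
  \big[op/idx]_(y <- orbit f x) F (f y) = \big[op/idx]_(y <- orbit f x) F y.
Proof.
rewrite !(big_orbit_perm f_inj) [RHS](reindex_inj f_inj) /=.
apply: eq_bigl => y.
by rewrite -!eq_porbit_mem -[f y](permE f_inj) (porbit_perm _ 1).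
Qed.

(** * Parity of the Euler characteristic *)

Section Net.

Variable X : oriented_net.

Local Notation opp := (@Defs.opp X : dart X -> dart X).

Definition prev_side (d : dart X) : dart X :=
  Tagged (fun f => 'I_(nsides f)) (ord_pred (tagged d)).

(** The marked side of each face: the one where the arguments of the sides,
    followed counterclockwise, will jump back by a full turn. *)
Definition first_side (d : dart X) : bool := tagged d == 0 :> nat.

Lemma next_sideK : cancel (@next_side X) prev_side.
Proof. by case=> f k; rewrite /prev_side /next_side /= ordSK. Qed.

Lemma oppK : involutive opp. Proof. exact: opp_invol. Qed.

Definition opp_inj : injective opp := inv_inj oppK.
Definition next_inj : injective (@next_side X) := can_inj next_sideK.
Lemma cw_inj : injective (@cw X).
Proof. by move=> d d' /next_inj /opp_inj. Qed.

Local Notation opp_perm := (perm opp_inj).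
Local Notation next_perm := (perm next_inj).
Local Notation cw_perm := (perm cw_inj).

Lemma opp_neq (d : dart X) : opp d != d.
Proof. by apply: contraNneq (two_faces d) => {2}<-. Qed.

Lemma nsides_gt0 (f : face X) : 0 < nsides f.
Proof. by have := nsides_gt2 f; case: nsides. Qed.

Definition side0 (f : face X) : dart X :=
  Tagged (fun f => 'I_(nsides f)) (Ordinal (nsides_gt0 f)).

Lemma iter_next_side0 (f : face X) n (ltn : n < nsides f) :
  iter n (@next_side X) (side0 f) =
  Tagged (fun f => 'I_(nsides f)) (Ordinal ltn).
Proof.
elim: n ltn => [|n IHn] ltn /=; first by congr Tagged; apply: val_inj.
rewrite (IHn (ltnW ltn)); congr Tagged; apply: val_inj => /=.
by rewrite modn_small.
Qed.

Lemma fconnect_side0 (d : dart X) :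
  fconnect (@next_side X) (side0 (tag d)) d.
Proof.
case: d => f [n ltn].
by rewrite -[X in fconnect _ _ X](iter_next_side0 ltn) fconnect_iter.
Qed.

Lemma tag_porbit_next (d d' : dart X) :
  d' \in porbit next_perm d -> tag d' = tag d.
Proof. by rewrite -fconnect_perm => /iter_findex <-; elim: findex. Qed.

Lemma first_sideE (d : dart X) : first_side d -> d = side0 (tag d).
Proof. by case: d => f k /eqP /= k0; congr Tagged; apply: val_inj. Qed.

Lemma card_porbits_next : #|porbits next_perm| = #|first_side|.
Proof.
apply: card_porbits_transversal => [d | d d' fd fd' /tag_porbit_next eqt].
  exists (side0 (tag d)) => //.
  by rewrite porbit_sym -fconnect_perm fconnect_side0.
by rewrite (first_sideE fd) (first_sideE fd') eqt.
Qed.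

Section Orientation.

(* [eps] is an orientation of the edges: it selects one of their two darts. *)
Variables (eps : dart X -> bool) (eps_opp : forall d, eps (opp d) = ~~ eps d).

Lemma porbit_opp (d d' : dart X) :
  (d' \in porbit opp_perm d) = (d' == d) || (d' == opp d).
Proof.
apply/porbitP/orP => [[n ->] | [] /eqP->]; last 1 first.
- by exists 1; rewrite permE.
- elim: n => [|n]; rewrite ?perm1 ?expgSr ?permM ?permE; first by left.
  by case=> /eqP->; rewrite ?oppK eqxx; [right | left].
- by exists 0; rewrite perm1.
Qed.

Lemma card_porbits_opp : #|porbits opp_perm| = #|eps|.
Proof.
apply: card_porbits_transversal => [d | d d' ed ed'].
  have [ed | ed] := boolP (eps d); first by exists d => //; apply: porbit_id.
  by exists (opp d); rewrite ?eps_opp // porbit_opp eqxx orbT.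
rewrite porbit_opp => /predU1P[-> // | /eqP d'E].
by move: ed'; rewrite d'E /in_mem /= eps_opp [eps d]ed.
Qed.

Lemma card_dart_even : ~~ odd #|dart X|.
Proof.
rewrite -(cardC eps).
have -> : #|[predC eps]| = #|eps|.
  rewrite -(card_image opp_inj eps); apply: eq_card => d.
  apply/idP/imageP => [ed | [d' ed' ->]].
    by exists (opp d); rewrite ?oppK // unfold_in eps_opp.
  by rewrite !inE /in_mem /= eps_opp negbK.
by rewrite addnn odd_double.
Qed.

(** The left-hand side counts the edges, each through its selected dart, and
    the faces, each through its marked side; the right-hand side counts the
    vertices.  Since [cw] is the product of [opp] and [next_side], its sign is
    the product of theirs, and the number of darts, which is twice the number of
    edges, does not contribute to these signs. *)
Lemma euler_parity :
  \big[addb/false]_d (eps d (+) first_side d) = odd #|porbits cw_perm|.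
Proof.
have cwE : cw_perm = (opp_perm * next_perm)%g.
  by apply/permP => d; rewrite permM !permE.
have := congr1 (@odd_perm (dart X)) cwE.
rewrite odd_permM /odd_perm (negbTE card_dart_even) /= => ->.
by rewrite big_split /= !addb_card card_porbits_next card_porbits_opp.
Qed.

End Orientation.

(** * Correcting the parity at the vertices *)

Lemma exists_orientation :
  exists eps : dart X -> bool, forall d, eps (opp d) = ~~ eps d.
Proof.
exists (fun d => enum_rank d < enum_rank (opp d)) => d.
rewrite oppK -leqNgt [RHS]leq_eqVlt; case: eqP => // /ord_inj eqr.
by have := opp_neq d; rewrite (enum_rank_inj eqr) eqxx.
Qed.

(** A set [phi] of edges (closed under [opp]) whose boundary modulo 2 consists
    of the origins of d and d': adding it to an orientation of the edges changes
    the parity at these two vertices only.  Being joined in this sense is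
    an equivalence relation, whereas paths of edges would have to be reversed
    and concatenated. *)
Definition joined (d d' : dart X) : Prop :=
  exists2 phi : dart X -> bool, forall c, phi (opp c) = phi c &
    forall B, B \in porbits cw_perm ->
      \big[addb/false]_(c in B) phi c = (d \in B) (+) (d' \in B).

Lemma joined_refl d : joined d d.
Proof. by exists (fun=> false) => // B _; rewrite big1 // addbb. Qed.

Lemma joined_trans d2 d1 d3 : joined d1 d2 -> joined d2 d3 -> joined d1 d3.
Proof.
move=> [phi phi_opp phiE] [psi psi_opp psiE].
exists (fun c => phi c (+) psi c) => [c|B BP]; first by rewrite phi_opp psi_opp.
by rewrite big_split /= phiE // psiE // addbA addbK.
Qed.

Lemma joined_cw d : joined d (cw d).
Proof.
exists (fun=> false) => // B /imsetP[c _ ->]; rewrite big1 //.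
by rewrite -!eq_porbit_mem -[cw d](permE cw_inj) (porbit_perm _ 1) addbb.
Qed.

Lemma joined_opp d : joined d (opp d).
Proof.
exists (fun c => (c == d) || (c == opp d)) => [c | B _].
  by rewrite orbC (inj_eq opp_inj) (canF_eq oppK).
transitivity (\big[addb/false]_(c in B) ((c == d) (+) (c == opp d))).
  apply: eq_bigr => c _; case: eqVneq => // ->.
  by rewrite eq_sym (negbTE (opp_neq d)).
have sum_pred1 a : \big[addb/false]_(c in B) (c == a) = (a \in B).
  rewrite big_mkcond (bigD1 a) //= eqxx big1 ?addbF; first by case: ifP.
  by move=> c /negbTE ->; rewrite if_same.
by rewrite big_split /= !sum_pred1.
Qed.

Lemma joined_next d : joined d (next_side d).
Proof.
apply: joined_trans (joined_opp d) _.
by have := joined_cw (opp d); rewrite /cw oppK.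
Qed.

Lemma joined_sym d d' : joined d d' -> joined d' d.
Proof.
by case=> phi ? phiE; exists phi => // B BP; rewrite phiE // addbC.
Qed.

Lemma joined_tag d d' : tag d = tag d' -> joined d d'.
Proof.
have joined0 c : joined (side0 (tag c)) c.
  rewrite -{2}(iter_findex (fconnect_side0 c)).
  elim: findex => [|n IHn] /=; first exact: joined_refl.
  exact: joined_trans IHn (joined_next _).
move=> eqt; apply: joined_trans (joined_sym (joined0 d)) _.
by rewrite eqt; apply: joined0.
Qed.

(** Adjacent darts of a face and the two darts of an edge are joined, so a chain
    of adjacent faces joins any two darts. *)
Lemma joined_all d d' : joined d d'.
Proof.
have /connectP[p] := net_connected (tag d) (tag d').
elim: p d => [|f p IHp] d /=; first by move=> _ /esym/joined_tag.
case/andP=> /existsP[c /andP[/eqP tc /eqP toc]] pp lastp.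
apply: joined_trans (joined_tag (esym tc)) _.
apply: joined_trans (joined_opp c) _; apply: IHp; rewrite toc //.
Qed.

(** Every bad vertex is joined to a root, and the sum of the corresponding sets
    of edges is added to an arbitrary orientation.  This corrects all vertices
    except possibly that of the root, which is then correct because
    [euler_parity] holds for the new orientation as well. *)
Lemma exists_spin_signs :
  exists2 eps : dart X -> bool, forall d, eps (opp d) = ~~ eps d &
    forall d, \big[addb/false]_(c <- orbit (@cw X) d)
                (eps c (+) first_side c) = true.
Proof.
have [eps0 eps0_opp] := exists_orientation.
suff [eps eps_opp epsE] : exists2 eps : dart X -> bool,
    forall d, eps (opp d) = ~~ eps d &
    forall B, B \in porbits cw_perm ->
      \big[addb/false]_(c in B) (eps c (+) first_side c) = true.
  exists eps => // d; rewrite (big_orbit_perm cw_inj).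
  by apply: epsE; apply: imset_f.
(* Without darts there is no vertex at all. *)
have [root _ | noroot] := pickP (dart X); last first.
  by exists eps0 => // B /imsetP[d]; have := noroot d.
pose bad (B : {set dart X}) :=
  ~~ \big[addb/false]_(c in B) (eps0 c (+) first_side c).
have /fin_all_exists2[phi phi_opp phiE] d := joined_all d root.
pose rep (B : {set dart X}) := odflt root [pick d in B].
have rep_in B : B \in porbits cw_perm -> rep B \in B.
  case/imsetP=> d _ ->; rewrite /rep; case: pickP => //= /(_ d).
  by rewrite porbit_id.
have mem_rep B C : B \in porbits cw_perm -> C \in porbits cw_perm ->
    (rep C \in B) = (C == B).
  move=> BP CP; apply/idP/eqP => [|<-]; last exact: rep_in.
  have := rep_in _ CP; case/imsetP: BP => b _ ->; case/imsetP: CP => c _ -> /=.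
  by rewrite -!eq_porbit_mem => /eqP-> /eqP.
(* The set phi c joins c to the root. *)
pose eps d := eps0 d (+)
  \big[addb/false]_(B in porbits cw_perm | bad B) phi (rep B) d.
have eps_opp d : eps (opp d) = ~~ eps d.
  rewrite /eps eps0_opp -addNb; congr addb.
  by apply: eq_bigr => B _; rewrite phi_opp.
exists eps => //.
have good B : B \in porbits cw_perm -> root \notin B ->
    \big[addb/false]_(c in B) (eps c (+) first_side c) = true.
  move=> BP rB; transitivity (~~ bad B (+) bad B); last by case: (bad B).
  rewrite negbK; under eq_bigr do rewrite addbAC.
  rewrite big_split /=; congr addb; rewrite exchange_big /=.
  transitivity (\big[addb/false]_(C in porbits cw_perm | bad C) (C == B)).
    apply: eq_bigr => C /andP[CP _].
    by rewrite phiE // mem_rep // (negbTE rB) addbF.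
  rewrite big_mkcond (bigD1 B) //= BP eqxx big1 ?addbF; first by case: (bad B).
  by move=> C /negbTE ->; rewrite if_same.
move=> B BP; have [rB | /good -> //] := boolP (root \in B).
have total : \big[addb/false]_(C in porbits cw_perm)
    \big[addb/false]_(c in C) (eps c (+) first_side c) = odd #|porbits cw_perm|.
  rewrite -(euler_parity eps_opp) [RHS](big_partition_porbits cw_perm) //.
move: total; rewrite (bigD1 B) //= (cardD1 B) BP oddD -sum1_card odd_sum_addb.
rewrite [X in _ (+) X](eq_bigr (fun=> true)) => [|C /andP[CP CB]].
  rewrite [X in _ = _ (+) X](eq_bigl
    (fun C => (C \in porbits cw_perm) && (C != B))); first by move/addIb.
  by move=> C; rewrite !inE andbC.
apply: good => //; apply: contraNN CB => rC; apply/eqP.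
case/imsetP: BP rB => x _ ->; case/imsetP: CP rC => y _ ->.
by rewrite -!eq_porbit_mem => /eqP <- /eqP <-.
Qed.

End Net.

Local Open Scope ring_scope.

(** * Arguments of plane vectors *)

Section Polar.
Variable R : realType.
Implicit Types (x y t : R).

Lemma sin_lt0_2pi t : pi < t < 2 * pi -> sin t < 0.
Proof.
move=> /andP[? ?]; have -> : t = t - pi + pi by ring.
by rewrite sinDpi oppr_lt0 sin_gt0_pi //; apply/andP; split; lra.
Qed.

Lemma sin_gt0_cases t : - (2 * pi) < t < 2 * pi -> 0 < sin t ->
  0 < t < pi \/ t < - pi.
Proof.
move=> /andP[t1 t2] st; have pi0 := pi_gt0 R.
case: (ltP t (- pi)) => [? | t3]; [by right | left].
case: (ltP 0 t) => [t0 | t0] /=.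
  case: (ltrgtP t pi) => // tpi; last by rewrite tpi sinpi ltxx in st.
  have := @sin_lt0_2pi t; rewrite tpi t2 => /(_ isT)/(lt_trans st).
  by rewrite ltxx.
have := @sin_ge0_pi _ (- t); rewrite sinN.
have -> : 0 <= - t <= pi by apply/andP; split; lra.
by move=> /(_ isT); rewrite oppr_ge0 leNgt st.
Qed.

Lemma eq0_of_cos1 t : 0 <= t < 2 * pi -> cos t = 1 -> t = 0.
Proof.
move=> /andP[t0 t2] cost; have pi0 := pi_gt0 R.
have sint : sin t = 0.
  by apply/eqP; rewrite -sqrf_eq0 sin2cos2 cost expr1n subrr.
case: (ltrgtP t pi) => [tpi | tpi | tE].
- apply/eqP; rewrite eq_le t0 andbT leNgt; apply/negP => t_gt0.
  by have := @sin_gt0_pi _ t; rewrite t_gt0 tpi sint ltxx => /(_ isT).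
- by have := @sin_lt0_2pi t; rewrite tpi t2 sint ltxx => /(_ isT).
by move: cost; rewrite tE cospi; lra.
Qed.

Lemma polar r x y : 0 < r -> x ^+ 2 + y ^+ 2 = r ^+ 2 ->
  exists t, [/\ 0 <= t < 2 * pi, x = r * cos t & y = r * sin t].
Proof.
move=> r0 xyr; have pi0 := pi_gt0 R; have r_neq0 : r != 0 by rewrite gt_eqF.
(* The argument is acos u in the upper half plane and 2 pi - acos u below. *)
pose u := x / r; pose v := y / r.
have uv1 : v ^+ 2 = 1 - u ^+ 2.
  have yE : y ^+ 2 = r ^+ 2 - x ^+ 2 by rewrite -xyr; ring.
  by rewrite /u /v !expr_div_n yE; field.
have u1 : -1 <= u <= 1.
  rewrite -ler_norml -(expr_le1 (n := 2)) ?normr_ge0 // real_normK ?num_real //.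
  by have := sqr_ge0 v; lra.
have [/andP[a0 api] cosa] := acos_def u1.
have sina : sin (acos u) = `|v| by rewrite sin_acos // -uv1 sqrtr_sqr.
have [v0 | v0] := lerP 0 v.
  exists (acos u); split; first by apply/andP; split; lra.
  - by rewrite cosa /u; field.
  - by rewrite sina ger0_norm // /v; field.
rewrite ltr0_norm // in sina.
exists (2 * pi - acos u).
have cosE : cos (2 * pi - acos u) = u.
  by rewrite mulr_natl addrC cosD2pi cosN.
have sinE : sin (2 * pi - acos u) = v.
  by rewrite mulr_natl addrC sinD2pi sinN sina opprK.
split; last 2 first.
- by rewrite cosE /u; field.
- by rewrite sinE /v; field.
apply/andP; split; first lra.
rewrite ltrBlDr ltrDl lt_neqAle a0 andbT; apply: contraTneq v0 => a0'.
by rewrite -leNgt -oppr_le0 -sina -a0' sin0.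
Qed.

End Polar.

(** * Coordinates in an oriented Euclidean plane *)

Section Plane.
Variables (R : realType) (P : eplane R).
Implicit Types (u v w : tangent P) (a : R) (p q r : point P).

Lemma innerDl u v w : inner (u + v) w = inner u w + inner v w.
Proof. by rewrite -{1}[u]scale1r inner_linear mul1r. Qed.

Lemma inner0l w : inner 0 w = 0.
Proof. by apply: (addrI (inner 0 w)); rewrite -innerDl !addr0. Qed.

Lemma innerZl a u w : inner (a *: u) w = a * inner u w.
Proof. by rewrite -[a *: u]addr0 inner_linear inner0l addr0. Qed.

Lemma innerDr u v w : inner w (u + v) = inner w u + inner w v.
Proof. by rewrite !(inner_sym w) innerDl. Qed.

Lemma innerZr a u w : inner w (a *: u) = a * inner w u.
Proof. by rewrite !(inner_sym w) innerZl. Qed.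

Lemma areaDl u v w : area (u + v) w = area u w + area v w.
Proof. by rewrite -{1}[u]scale1r area_linear mul1r. Qed.

Lemma area0l w : area 0 w = 0.
Proof. by apply: (addrI (area 0 w)); rewrite -areaDl !addr0. Qed.

Lemma areaZl a u w : area (a *: u) w = a * area u w.
Proof. by rewrite -[a *: u]addr0 area_linear area0l addr0. Qed.

Lemma areaDr u v w : area w (u + v) = area w u + area w v.
Proof. by rewrite !(area_anti w) areaDl opprD. Qed.

Lemma areaZr a u w : area w (a *: u) = a * area w u.
Proof. by rewrite !(area_anti w) areaZl mulrN. Qed.

Lemma areaxx u : area u u = 0.
Proof. by have := area_anti u u; lra. Qed.

Lemma vectxx p : vect p p = 0.
Proof. by apply: (addrI (vect p p)); rewrite vect_chasles addr0. Qed.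

Lemma vectN p q : vect q p = - vect p q.
Proof. by apply: (addrI (vect p q)); rewrite vect_chasles vectxx subrr. Qed.

Lemma norm_gt0 u : u != 0 -> 0 < norm u.
Proof. by move=> /inner_gt0; rewrite /norm sqrtr_gt0. Qed.

Lemma sqr_norm u : norm u ^+ 2 = inner u u.
Proof.
rewrite /norm sqr_sqrtr //; have [->|/inner_gt0/ltW //] := eqVneq u 0.
by rewrite inner0l.
Qed.

Lemma normZ a u : norm (a *: u) = `|a| * norm u.
Proof.
by rewrite /norm innerZl innerZr mulrA -expr2 sqrtrM ?sqr_ge0 // sqrtr_sqr.
Qed.

Section Frame.
Variable b : frame P.

Local Notation x u := (inner (fr1 b) u).
Local Notation y u := (inner (fr2 b) u).

Lemma frame_decomposition u : u = x u *: fr1 b + y u *: fr2 b.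
Proof.
have bb : basis_of fullv [:: fr1 b; fr2 b].
  rewrite basisEfree tangent_dim subvf !andbT.
  apply/freeP => /= k kE i.
  move: kE; rewrite !big_ord_recl big_ord0 /= addr0 => kE.
  have := congr1 (inner (fr1 b)) kE; have := congr1 (inner (fr2 b)) kE.
  rewrite !innerDr !innerZr fr1_unit fr2_unit (inner_sym (fr2 b)) fr_orth.
  rewrite !(inner_sym _ 0) !inner0l !mulr0 !mulr1 addr0 add0r => k1 k0.
  have [->|/eqP] := eqVneq i ord0; first exact: k0.
  by case: (unliftP ord0 i) => [j ->|] //; rewrite (ord1 j).
have := coord_basis bb (memvf u); rewrite !big_ord_recl big_ord0 /= addr0.
move=> uE; rewrite [in x u]uE [in y u]uE.
rewrite !innerDr !innerZr fr1_unit fr2_unit (inner_sym (fr2 b)) fr_orth.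
by rewrite !mulr0 !mulr1 addr0 add0r.
Qed.

Lemma inner_frame u v : inner u v = x u * x v + y u * y v.
Proof. by rewrite {1}(frame_decomposition u) innerDl !innerZl. Qed.

Lemma area_frame u v : area u v = x u * y v - y u * x v.
Proof.
rewrite {1}(frame_decomposition u) {1}(frame_decomposition v).
rewrite !(areaDl, areaDr, areaZl, areaZr) !areaxx fr_oriented.
rewrite (area_anti (fr2 b)) fr_oriented; ring.
Qed.

(** With u and v consecutive sides of a polygon, w a reference direction and z
    seen from the common corner, this expresses the height of z over w by those
    of the two sides; area u z and area v z are nonnegative for z inside. *)
Lemma pluecker u v w z :
  area u v * area w z = area u z * area w v - area v z * area w u.
Proof. by rewrite !area_frame; ring. Qed.

End Frame.
End Plane.

(** * The turning of a convex polygon *)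

Lemma ordS_neq n (k : 'I_n) : (1 < n)%N -> ordS k != k.
Proof.
case: k => k lt n1; apply/eqP => /(congr1 val) /=.
case: (ltngtP k.+1 n) lt => // [lt _ | kn _]; first by rewrite modn_small; lia.
by rewrite kn modnn; lia.
Qed.

Lemma ordSS_neq n (k : 'I_n) : (2 < n)%N -> ordS (ordS k) != k.
Proof.
case: k => k lt n2; apply/eqP => /(congr1 val) /=.
case: (ltngtP k.+1 n) lt => // [lt _ | kn _]; last first.
  by rewrite kn modnn modn_small; lia.
rewrite (modn_small lt); case: (ltngtP k.+2 n) lt => // [lt _ | kn _].
  by rewrite modn_small; lia.
by rewrite kn modnn; lia.
Qed.

(** Going around a convex polygon the side makes exactly one turn, so its
    argument can be taken to increase by each exterior angle, except when the
    tour comes back to side 0, where it drops by 2 pi.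

    Arguments t are measured in [0, 2 pi) from side 0.  At every corner the turn
    d = t (k+1) - t k has a positive sine, because the polygon turns left; hence
    d is the exterior angle, or this angle minus 2 pi.  In the second case side
    k points below the direction of side 0 and side k+1 does not, so the corner
    between them is a local minimum of the height above side 0.  The polygon
    lies in the cone to the left of both sides, hence no lower than this corner.
    But a corner that is not on side 0 is strictly higher than corner 0. *)
Lemma side_arguments (R : realType) (P : eplane R) (b : frame P) n
    (c : 'I_n -> point P) (e : 'I_n -> tangent P) :
    convex_ccw c -> (forall k, e k != 0) ->
    (forall k, exists2 t : R, 0 < t & vect (c k) (c (ordS k)) = t *: e k) ->
  exists2 theta : 'I_n -> R,
    forall k, quat_of b (e k) = Quat 0 (norm (e k) * cos (theta k))
                                       (norm (e k) * sin (theta k)) 0 &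
    forall k, theta k - theta (ord_pred k) =
              pi - interior_angle c k - 2 * pi *+ (k == 0 :> nat).
Proof.
move=> [n2 convex] e0 /fin_all_exists2[tau tau0 sideE].
have pi0 := pi_gt0 R.
have n0 : (0 < n)%N by lia.
pose k0 := Ordinal n0.
pose x k := inner (fr1 b) (e k); pose y k := inner (fr2 b) (e k).
have r0 k : 0 < norm (e k) by apply: norm_gt0.
have xyr k : x k ^+ 2 + y k ^+ 2 = norm (e k) ^+ 2.
  by rewrite sqr_norm (inner_frame b) !expr2.
have [phi [_ xphi yphi]] := polar (r0 k0) (xyr k0).
(* Arguments relative to phi are arguments of the vectors rotated by - phi. *)
have polar_k k : exists t, [/\ 0 <= t < 2 * pi,
    x k = norm (e k) * cos (phi + t) & y k = norm (e k) * sin (phi + t)].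
  have [|t [t_range xt yt]] := @polar _ (norm (e k))
    (x k * cos phi + y k * sin phi) (y k * cos phi - x k * sin phi) (r0 k).
    rewrite -xyr -[RHS]mulr1 -(cos2Dsin2 phi); ring.
  exists t; split=> //; rewrite ?cosD ?sinD.
    rewrite mulrBr mulrCA -xt [_ * (sin phi * _)]mulrCA -yt.
    by rewrite -[LHS]mulr1 -(cos2Dsin2 phi); ring.
  rewrite mulrDr mulrCA -xt [_ * (cos phi * _)]mulrCA -yt.
  by rewrite -[LHS]mulr1 -(cos2Dsin2 phi); ring.
have /fin_all_exists[t tP] := polar_k.
have t_ge0 k : 0 <= t k by have [/andP[]] := tP k.
have t_lt k : t k < 2 * pi by have [/andP[]] := tP k.
have area_e j k : area (e j) (e k) = norm (e j) * norm (e k) * sin (t k - t j).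
  rewrite (area_frame b) -!/(x _) -!/(y _).
  have [_ -> ->] := tP j; have [_ -> ->] := tP k.
  have -> : t k - t j = (phi + t k) - (phi + t j) by ring.
  by rewrite sinB; ring.
have inner_e j k :
    inner (e j) (e k) = norm (e j) * norm (e k) * cos (t k - t j).
  rewrite (inner_frame b) -!/(x _) -!/(y _).
  have [_ -> ->] := tP j; have [_ -> ->] := tP k.
  have -> : t k - t j = (phi + t k) - (phi + t j) by ring.
  by rewrite cosB; ring.
have t_k0 : t k0 = 0.
  have [t_range xt yt] := tP k0.
  have cosE : cos (phi + t k0) = cos phi.
    by apply: (mulfI (lt0r_neq0 (r0 k0))); rewrite -xt -xphi.
  have sinE : sin (phi + t k0) = sin phi.
    by apply: (mulfI (lt0r_neq0 (r0 k0))); rewrite -yt -yphi.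
  apply: eq0_of_cos1 => //.
  have -> : t k0 = (phi + t k0) - phi by ring.
  by rewrite cosB cosE sinE -!expr2 cos2Dsin2.
have side_area k l : l != k -> l != ordS k ->
    0 < area (e k) (vect (c k) (c l)).
  by move=> lk lSk; have := convex k l lk lSk; rewrite sideE areaZl pmulr_rgt0.
have turn_gt0 k : 0 < area (e k) (e (ordS k)).
  have := side_area k _ (ordSS_neq k n2) (ordS_neq _ (ltnW n2)).
  rewrite -(vect_chasles (c k) (c (ordS k))) !sideE areaDr !areaZr areaxx.
  by rewrite mulr0 add0r pmulr_rgt0.
have sin_turn k : 0 < sin (t (ordS k) - t k).
  by have := turn_gt0 k; rewrite area_e pmulr_rgt0 // mulr_gt0.
have angleE k : interior_angle c (ordS k) = acos (- cos (t (ordS k) - t k)).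
  rewrite /interior_angle /angle ordSK vectN !sideE; congr acos.
  rewrite -scaleNr innerZl innerZr inner_e !normZ normrN !gtr0_norm //.
  by field; rewrite !gt_eqF.
exists (fun k => phi + t k) => [k | k'].
  by rewrite /quat_of -/(x k) -/(y k); have [_ -> ->] := tP k.
rewrite -(ord_predK k'); move: (ord_pred k') => {k'} k; rewrite ordSK angleE.
have -> : phi + t (ordS k) - (phi + t k) = t (ordS k) - t k by ring.
set d := t (ordS k) - t k.
have d_range : - (2 * pi) < d < 2 * pi.
  have := t_ge0 k; have := t_ge0 (ordS k); have := t_lt k.
  by have := t_lt (ordS k); rewrite /d => *; apply/andP; split; lra.
have dP := sin_gt0_cases d_range (sin_turn k).
(* The interior angle is measured by acos, hence lies in [0, pi]; the next two
   facts compute it in both cases of dP. *)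
have left_turn : 0 < d < pi -> acos (- cos d) = pi - d.
  move=> /andP[? ?]; rewrite -cosN -cosDpi addrC cosK //.
  by rewrite in_itv /=; apply/andP; split; lra.
have wrap : d < - pi -> acos (- cos d) = - pi - d.
  move=> ?; rewrite -cosDpi -cosN opprD addrC cosK //; case/andP: d_range => *.
  by rewrite in_itv /=; apply/andP; split; lra.
(* Back at side 0 the argument is 0, so d is not positive. *)
have [Sk0 | Sk0] := eqVneq (ordS k : nat) 0%N.
  rewrite mulr1n wrap; first ring.
  case: dP => // /andP[d0 _]; have := t_ge0 k; move: d0; rewrite /d.
  by rewrite (_ : ordS k = k0) ?t_k0; [lra | apply: val_inj].
rewrite mulr0n; case: dP => [/left_turn -> | dpi]; first ring.
(* Leaving side 0, d is not negative. *)
have kk0 : k != k0.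
  apply: contraTneq dpi => kk0; rewrite -leNgt /d kk0 t_k0.
  by have := t_ge0 (ordS k0); lra.
exfalso.
(* Heights are measured by the area form against the direction of side 0. *)
have Sk0' : ordS k != k0 by rewrite -val_eqE.
have SkS0 : ordS k != ordS k0 by rewrite (inj_eq (@ordS_inj _)).
have up : 0 <= area (e k0) (e (ordS k)).
  rewrite area_e t_k0 subr0 !mulr_ge0 ?(ltW (r0 _)) // sin_ge0_pi // t_ge0 /=.
  by have := t_lt k; move: dpi; rewrite /d; lra.
have down : area (e k0) (e k) <= 0.
  rewrite area_e t_k0 subr0 pmulr_rle0 ?mulr_gt0 // ltW // sin_lt0_2pi //.
  have := t_ge0 (ordS k); move: dpi (t_lt k).
  by rewrite /d => *; apply/andP; split; lra.
have high : area (e k0) (vect (c (ordS k)) (c k0)) < 0.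
  by rewrite vectN -scaleN1r areaZr mulN1r oppr_lt0 side_area.
have left1 : 0 <= area (e k) (vect (c (ordS k)) (c k0)).
  have := side_area k k0; rewrite ![k0 == _]eq_sym => /(_ kk0 Sk0') /ltW.
  rewrite -(vect_chasles (c k) (c (ordS k))) sideE areaDr areaZr areaxx.
  by rewrite mulr0 add0r.
have left2 : 0 <= area (e (ordS k)) (vect (c (ordS k)) (c k0)).
  have [-> | SSk0] := eqVneq k0 (ordS (ordS k)).
    by rewrite sideE areaZr areaxx mulr0.
  by apply/ltW/side_area; rewrite // eq_sym.
have := pluecker b (e k) (e (ordS k)) (e k0) (vect (c (ordS k)) (c k0)).
by have := turn_gt0 k; nra.
Qed.
(** * The group Spin(2) *)

Section Spin.
Variable R : realType.
Implicit Types a t r : R.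

Lemma expkD a a' : expk (a + a') = expk a * expk a'.
Proof. by rewrite /expk cosD sinD; congr Quat; rewrite /=; ring. Qed.

Lemma expk0 : expk (0 : R) = 1.
Proof. by rewrite /expk cos0 sin0. Qed.

Lemma expkN a : expk (- a) = (expk a)^-1.
Proof.
have expk_unit : expk a \is a GRing.unit.
  by apply/unitrP; exists (expk (- a)); rewrite -!expkD addNr subrr expk0.
by apply: (mulrI expk_unit); rewrite -expkD subrr expk0 divrr.
Qed.

Lemma expkD2pi a m : expk (a + 2 * pi *+ m) = expk a.
Proof.
elim: m => [|m IHm]; first by rewrite mulr0n addr0.
rewrite mulrSr addrA expkD IHm -[RHS]mulr1.
by congr (_ * _); rewrite mulr_natl /expk cos2pi sin2pi.
Qed.

Lemma expk_sum (I : Type) (s : seq I) (F : I -> R) :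
  \prod_(i <- s) expk (F i) = expk (\sum_(i <- s) F i).
Proof. by rewrite (big_morph (@expk R) expkD expk0). Qed.

(** Elements of span(i, j) anticommute with k, so the two factors act on the
    same side and rotate twice by - a. *)
Lemma expk_conj a r t :
  expk (- a) * Quat 0 (r * cos t) (r * sin t) 0 * expk a =
  Quat 0 (r * cos (t - a *+ 2)) (r * sin (t - a *+ 2)) 0.
Proof.
rewrite mulr2n opprD addrA !(cosB, sinB) /expk cosN sinN.
by congr Quat; rewrite /=; ring.
Qed.

End Spin.

Lemma tag_cw (X : oriented_net) (d : dart X) : tag (cw d) = tag (Defs.opp d).
Proof. by []. Qed.

Lemma opp_prev_cw (X : oriented_net) (d : dart X) :
  Defs.opp d = prev_side (cw d).
Proof. by rewrite /cw next_sideK. Qed.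

(** * The preferred lifting *)

Theorem theorem5p11 (R : realType) (X : oriented_net) (A : intrinsic_net R X)
    (b : frames A) :
  exists g : face X -> face X -> quat R, preferred_lifting b g.
Proof.
have /fin_all_exists2[th thE turnE] f := side_arguments (b f)
  (@corner_convex R X A f) (@evec_neq0 R X A f) (@side_directed R X A f).
pose theta (d : dart X) := th (tag d) (tagged d).
pose int_angle (d : dart X) :=
  interior_angle (@corner R X A (tag d)) (tagged d).
have turn d : theta d - theta (prev_side d) =
    pi - int_angle d - 2 * pi *+ first_side d by apply: turnE.
have [eps eps_opp epsE] := exists_spin_signs X.
pose a (d : dart X) := (theta d - theta (Defs.opp d) - pi) / 2 + pi *+ eps d.
have a_opp d : a (Defs.opp d) = - a d.
  by rewrite /a oppK eps_opp; case: (eps d); rewrite /= ?mulr1n ?mulr0n; field.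
(* Two adjacent faces share a single edge, so a dart is determined by the two
   faces it separates and g can be indexed by faces. *)
pose g i j := if [pick d : dart X | (tag d == i) && (tag (Defs.opp d) == j)]
  is Some d then expk (a d) else 1.
have gE d : g (tag d) (tag (Defs.opp d)) = expk (a d).
  rewrite /g; case: pickP => [d' /andP[/eqP t1 /eqP t2] | /(_ d)].
    by rewrite (one_common_edge t1 t2).
  by rewrite !eqxx.
exists g; split=> d.
  have gopp : g (tag (Defs.opp d)) (tag d) = expk (- a d).
    by rewrite -a_opp -gE oppK.
  split; first by exists (a d); apply: gE.
    by rewrite gopp gE expkN.
  rewrite gE -expkN /qvec !thE expk_conj -(same_length A d) -!/(theta _).
  have -> : theta d - a d *+ 2 = theta (Defs.opp d) + pi - pi *+ 2 *+ eps d.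
    by rewrite /a; case: (eps d); rewrite ?mulr1n ?mulr0n; field.
  have -> : cos (theta (Defs.opp d) + pi - pi *+ 2 *+ eps d)
      = - cos (theta (Defs.opp d)).
    case: (eps d); last by rewrite subr0 cosDpi.
    by rewrite -[LHS]cosD2pi subrK cosDpi.
  have -> : sin (theta (Defs.opp d) + pi - pi *+ 2 *+ eps d)
      = - sin (theta (Defs.opp d)).
    case: (eps d); last by rewrite subr0 sinDpi.
    by rewrite -[LHS]sinD2pi subrK sinDpi.
  by congr Quat; rewrite /= ?oppr0 ?mulrN.
under eq_bigr do rewrite tag_cw gE.
rewrite expk_sum.
have := epsE d; under eq_bigr do rewrite -[eps _]oddb -[first_side _]oddb -oddD.
rewrite -odd_sum_addb; set N := \sum_(_ <- _) _ => oddN.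
pose M := (\sum_(c <- orbit (@cw X) d) first_side c)%N.
(* Side [opp c] precedes [cw c] in its face; shifting the sum of the
   theta (opp c) by one step around the vertex brings together the two sides
   meeting at each corner. *)
have -> : \sum_(c <- orbit (@cw X) d) a c =
    pi *+ N - 2 * pi *+ M - (\sum_(c <- orbit (@cw X) d) int_angle c) / 2.
  transitivity (\sum_(c <- orbit (@cw X) d)
      ((theta c - theta (prev_side c) - pi) / 2 + pi *+ eps c)).
    rewrite /a !big_split -!mulr_suml /= !big_split /= !sumrN.
    congr ((_ - _ + _) / 2 + _).
    under eq_bigr do rewrite opp_prev_cw.
    exact: (big_orbit_shift (@cw_inj X) _ _ (theta \o @prev_side X)).
  rewrite /N /M -!sumrMnr mulr_suml -!sumrN -!big_split /=.
  apply: eq_bigr => c _; rewrite turn -/(int_angle c) mulrnDr.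
  by case: (eps c); case: (first_side c); rewrite /= ?mulr1n ?mulr0n; field.
rewrite /angular_defect -[RHS](expkD2pi _ N./2) -[LHS](expkD2pi _ M).
congr expk; rewrite -{1}(odd_double_half N) oddN mulrnDr -mul2n mulrnA.
rewrite -[X in _ = (_ - X) / _ + _]/(\sum_(c <- orbit (@cw X) d) int_angle c).
by rewrite mulr1n -(mulr_natl pi 2); field.
Qed.
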